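(* For any wheel graph $W_n$, $n\ge 3$, we have $$\nu(W_n)=\nu(C_n)+1=3-2\cos(\pi/n).$$
   Context: All graphs $G=(V,E)$ are finite and simple; $x\sim y$ denotes adjacency. $E^{or}(G)$ is the set of ordered pairs $(x,y)$ with $x\sim y$. A magnetic potential is a map $\sigma:E^{or}(G)\to S^1=\{z\in\mathbb{C}:|z|=1\}$ with $\sigma(y,x)=\sigma(x,y)^{-1}$. The magnetic Laplacian on functions $f:V\to\mathbb{C}$ is $\Delta^\sigma f(x)=\sum_{y\sim x}(f(x)-\sigma(x,y)f(y))$, and $\lambda_1^\sigma(G)$ is its smallest eigenvalue. The magneto-spectral height is $\nu(G)=\sup_\sigma\lambda_1^\sigma(G)$, over all magnetic potentials. $C_n$ is the cycle with $n$ vertices, and the wheel graph $W_n$ (with $n+1$ vertices) is obtained from $C_n$ by adding one new vertex connected to all vertices of $C_n$. *)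

(* Defs.v *)
From HB Require Import structures.
From mathcomp Require Import all_boot all_order all_algebra.
From mathcomp Require Import complex.
From mathcomp Require Import all_classical all_reals all_analysis.

Set Implicit Arguments.
Unset Strict Implicit.
Unset Printing Implicit Defensive.

Import Order.TTheory GRing.Theory Num.Theory.

Local Open Scope classical_set_scope.
Local Open Scope ring_scope.
Local Open Scope complex_scope.

Record sgraph := SGraph {
  vertex :> finType;
  adj : rel vertex;
  adj_sym : symmetric adj;
  adj_irr : irreflexive adj }.

(* The values of a potential on non-adjacent pairs are unconstrained: they
   enter neither the Laplacian nor its spectrum. *)
Record potential (R : realType) (G : sgraph) := Potential {
  potential_fun :> G -> G -> R[i];
  potential_norm : forall x y, adj x y -> `|potential_fun x y| = 1;
  potential_inv : forall x y,
    adj x y -> potential_fun y x = (potential_fun x y)^-1 }.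

Section Laplacian.
Variables (R : realType) (G : sgraph) (sigma : potential R G).
Implicit Types f : {ffun G -> R[i]^o}.

Definition laplacian_fun f : {ffun G -> R[i]^o} :=
  [ffun x => \sum_(y | adj x y) (f x - sigma x y * f y)].

Lemma laplacian_fun_linear : linear laplacian_fun.
Proof.
move=> a f g; apply/ffunP => x; rewrite !ffunE scaler_sumr -big_split /=.
apply: eq_bigr => y _; rewrite !ffunE mulrDr scalerBr.
by rewrite -[a *: (sigma x y * f y)]/(a * _) mulrCA addrACA opprD.
Qed.

HB.instance Definition _ := GRing.isLinear.Build R[i] {ffun G -> R[i]^o}
  {ffun G -> R[i]^o} _ laplacian_fun laplacian_fun_linear.

Definition laplacian : 'End({ffun G -> R[i]^o}) := linfun laplacian_fun.

Lemma laplacianE f x :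
  laplacian f x = \sum_(y | adj x y) (f x - sigma x y * f y).
Proof. by rewrite lfunE ffunE. Qed.

Lemma leigenvalue_laplacianP (l : R[i]) :
  reflect (exists2 f, f != 0 & laplacian f = l *: f)
          (passmx.leigenvalue laplacian l).
Proof.
apply: (iffP idP) => [|[f f0 fE]].
  exists (vpick (passmx.leigenspace laplacian l)); first by rewrite vpick0.
  have := memv_pick (passmx.leigenspace laplacian l).
  rewrite memv_ker add_lfunE opp_lfunE scale_lfunE id_lfunE subr_eq0.
  by move/eqP.
apply: contra f0 => /eqP E; rewrite -memv0 -E memv_ker.
by rewrite add_lfunE opp_lfunE scale_lfunE id_lfunE fE subrr.
Qed.

(* Self-adjointness makes every eigenvalue real, so no eigenvalue is lost by
   letting l range over R; for nonempty G the infimum is attained and is the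
   smallest eigenvalue (lambda1_min). *)
Definition lambda1 : R := inf [set l : R | passmx.leigenvalue laplacian l%:C].

Lemma leigenvalue_laplacian_real (l : R[i]) :
  passmx.leigenvalue laplacian l -> l \is Num.real.
Proof.
case/leigenvalue_laplacianP=> f f0 fE.
pose S := \sum_x ((f x : R[i])^*)%R * (laplacian f x : R[i]).
pose N := \sum_x `|f x : R[i]| ^+ 2.
have SN : S = l * N.
  rewrite /S /N mulr_sumr; apply: eq_bigr => x _.
  by rewrite fE ffunE normCKC mulrCA.
have N0 : N != 0.
  apply: contra f0 => /eqP N0; apply/eqP/ffunP => x; rewrite ffunE.
  have /psumr_eq0P/(_ N0) : forall x, true -> 0 <= `|f x : R[i]| ^+ 2.
    by move=> y _; rewrite exprn_ge0.
  by move=> /(_ x isT)/eqP; rewrite expf_eq0 /= normr_eq0 => /eqP.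
have NR : N \is Num.real.
  by apply: rpred_sum => x _; rewrite rpredX // normr_real.
have SR : S \is Num.real.
  pose A := \sum_x \sum_(y | adj x y) `|f x : R[i]| ^+ 2.
  pose B := \sum_x \sum_(y | adj x y)
     ((f x : R[i])^*)%R * (sigma x y * (f y : R[i])).
  have -> : S = A - B.
    rewrite /S /A /B -sumrB; apply: eq_bigr => x _.
    rewrite laplacianE mulr_sumr -sumrB; apply: eq_bigr => y _.
    by rewrite mulrBr normCKC.
  rewrite rpredB //.
    by do 2!apply: rpred_sum => ? _; rewrite rpredX // normr_real.
  rewrite CrealE /B rmorph_sum /=.
  under eq_bigr => x _ do rewrite rmorph_sum /=.
  rewrite (exchange_big_dep xpredT) //=; apply/eqP/eq_bigr => y _.
  apply: eq_big => [x|x xy]; first by rewrite adj_sym.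
  rewrite (potential_inv sigma xy) !rmorphM /= conjCK.
  rewrite invC_norm (potential_norm sigma xy) expr1n invr1 mul1r.
  by rewrite mulrC mulrAC [_ * ((f y)^*)%R]mulrC mulrA.
by rewrite -(mulfK N0 l) -SN rpred_div.
Qed.

Lemma lambda1_min : (0 < #|G|)%N ->
  passmx.leigenvalue laplacian lambda1%:C /\
  (forall l, passmx.leigenvalue laplacian l -> lambda1%:C <= l).
Proof.
move=> G0.
have e_basis := vbasisP {:{ffun G -> R[i]^o}}.
set e := vbasis _ in e_basis.
pose p := char_poly (passmx.mxof e e laplacian).
have pE l : passmx.leigenvalue laplacian l = root p l.
  rewrite -eigenvalue_root_char /passmx.leigenvalue /eigenvalue.
  by rewrite (passmx.leigenspaceE e_basis) passmx.vsof_eq0.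
have p1 : size p != 1.
  rewrite size_char_poly eqSS.
  rewrite dimvf -[dim _]/(#|G| * 1)%N muln1 -lt0n //.
have /closed_rootP[l0 l0p] := p1.
have [rs pE'] := closed_field_poly_normal p.
have rootE l : root p l = (l \in rs).
  rewrite pE' rootZ ?root_prod_XsubC // lead_coef_eq0.
  by rewrite -size_poly_gt0 size_char_poly.
pose E := [set l : R | passmx.leigenvalue laplacian l%:C].
have EP l : l \in map (@complex.Re R) rs <-> E l.
  rewrite /E /= pE rootE; split => [/mapP[z zrs ->]|lrs].
    by rewrite RRe_real // leigenvalue_laplacian_real // pE rootE.
  by apply/mapP; exists l%:C.
set s := map _ _ in EP.
have l0s : complex.Re l0 \in s by rewrite map_f // -rootE.
have i0 : (index (complex.Re l0) s < size s)%N by rewrite index_mem.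
have [/= i _ iP] :=
  arg_minP (fun i : 'I_(size s) => s`_i) (erefl true : xpredT (Ordinal i0)).
have mE : lbound E s`_i.
  move=> l /EP ls; have j : (index l s < size s)%N by rewrite index_mem.
  by have := iP (Ordinal j) isT; rewrite /= nth_index.
have Em : E s`_i by apply/EP; rewrite mem_nth.
have -> : lambda1 = s`_i.
  apply/eqP; rewrite eq_le; apply/andP; split.
    by apply: ge_inf => //; exists s`_i.
  by apply: lb_le_inf => //; exists s`_i.
split=> // l ll; rewrite -(RRe_real (leigenvalue_laplacian_real ll)) lecR.
by apply: mE; rewrite /E /= RRe_real // leigenvalue_laplacian_real.
Qed.

Lemma lambda1_le : (0 < #|G|)%N -> lambda1 <= 2 * #|G|%:R.
Proof.
move=> G0; have [/leigenvalue_laplacianP[f f0 fE] _] := lambda1_min G0.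
have [x0 _] := card_gt0P G0.
have [/= x _ xP] :=
  arg_maxP (fun x => complex.Re `|f x : R[i]|) (erefl true : xpredT x0).
have {}xP y : `|f y : R[i]| <= `|f x : R[i]|.
  rewrite -[leLHS]RRe_real ?normr_real //.
  by rewrite -[leRHS]RRe_real ?normr_real // lecR xP.
have fx0 : 0 < `|f x : R[i]|.
  rewrite normr_gt0; apply: contra f0 => /eqP fx0; apply/eqP/ffunP => y.
  by apply/eqP; rewrite ffunE -normr_le0 (le_trans (xP y)) // fx0 normr0.
suff : `|lambda1%:C| <= (2 * #|G|%:R)%:C.
  move=> /(le_trans (real_ler_norm _)); rewrite lecR; apply.
  by apply/complex_realP; exists lambda1.
rewrite -(ler_pM2r fx0) -normrM.
have -> : lambda1%:C * f x = laplacian f x by rewrite fE ffunE.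
rewrite laplacianE (le_trans (ler_norm_sum _ _ _)) //.
have -> : (2 * #|G|%:R)%:C * `|f x : R[i]| = \sum_(y : G) (2 * `|f x : R[i]|).
  by rewrite sumr_const rmorphM !rmorph_nat -[RHS]mulr_natr mulrAC.
rewrite big_mkcond; apply: ler_sum => y _; case: ifP => [xy|_].
  rewrite (le_trans (ler_normB _ _)) // normrM (potential_norm sigma xy) mul1r.
  by rewrite mulr_natl mulr2n lerD2l xP.
by rewrite mulr_ge0.
Qed.

End Laplacian.

Section TrivialPotential.
Variables (R : realType) (G : sgraph).

Lemma trivial_norm (x y : G) : adj x y -> `|1 : R[i]| = 1.
Proof. by rewrite normr1. Qed.

Lemma trivial_inv (x y : G) : adj x y -> (1 : R[i]) = 1^-1.
Proof. by rewrite invr1. Qed.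

Definition trivial_potential : potential R G :=
  @Potential R G (fun _ _ => 1) trivial_norm trivial_inv.

End TrivialPotential.

(* A genuine supremum for nonempty G, by nu_has_sup. *)
Definition nu (R : realType) (G : sgraph) : R :=
  sup (range (@lambda1 R G)).

Lemma nu_has_sup (R : realType) (G : sgraph) :
  (0 < #|G|)%N -> has_sup (range (@lambda1 R G)).
Proof.
move=> G0; split.
  by exists (lambda1 (trivial_potential R G)), (trivial_potential R G).
by exists (2 * #|G|%:R) => _ [sigma _ <-]; exact: lambda1_le.
Qed.

Section Cycle.
Variable n : nat.

(* 'I_n carries the residues mod n; the guard i != j only matters for n = 1. *)
Definition cycle_adj : rel 'I_n := fun i j =>
  (i != j) && ((j == (i.+1 %% n)%N :> nat) || (i == (j.+1 %% n)%N :> nat)).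

Lemma cycle_adj_sym : symmetric cycle_adj.
Proof. by move=> i j; rewrite /cycle_adj eq_sym orbC. Qed.

Lemma cycle_adj_irr : irreflexive cycle_adj.
Proof. by move=> i; rewrite /cycle_adj eqxx. Qed.

Definition cycle_graph : sgraph := SGraph cycle_adj_sym cycle_adj_irr.

(* None is the hub, Some i the rim vertex i. *)
Definition wheel_adj : rel (option 'I_n) := fun u v =>
  match u, v with
  | Some i, Some j => cycle_adj i j
  | None, None => false
  | _, _ => true
  end.

Lemma wheel_adj_sym : symmetric wheel_adj.
Proof. by move=> [i|] [j|] //=; rewrite cycle_adj_sym. Qed.

Lemma wheel_adj_irr : irreflexive wheel_adj.
Proof. by move=> [i|] //=; rewrite cycle_adj_irr. Qed.

Definition wheel_graph : sgraph := SGraph wheel_adj_sym wheel_adj_irr.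

End Cycle.

(* Main.v *)
Require Import Defs.
From mathcomp Require Import all_boot all_order all_algebra.
From mathcomp Require Import all_classical all_reals all_analysis.
From mathcomp Require Import complex spectral sesquilinear ring lra.
Import Order.TTheory GRing.Theory Num.Theory.
Local Open Scope ring_scope.

(** Write c := cos (pi / n) and let T be the twisted shift
    (T v) i = w * v (i + 1) of functions on the rim Z/n.

    Upper bounds.  For any potential on the rim, with total phase e^(i alpha)
    around the cycle and alpha in [-pi, pi], transporting a value around the
    rim while spreading the phase evenly gives a nowhere vanishing g with
    sigma(i, i+1) g(i+1) = e^(i alpha / n) g(i) ([cycle_twist]).  It is an
    eigenfunction of the cycle with eigenvalue 2 - 2 cos (alpha / n), which is
    at most 2 - 2c.  On the wheel, g extended by 0 at the hub has Rayleigh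
    quotient 3 - 2 cos (alpha / n), since each rim vertex has one more
    neighbour, so the Rayleigh principle [lambda1_le_compression] gives the
    bound 3 - 2c whatever the phases on the spokes.

    Lower bounds.  Put the same phase w on every rim edge, with w^n = -1.  Then
    T^n = -1, so the Laplacian 2 - (T + T^-1) of the cycle has its spectrum
    among the numbers 2 - 2 Re z with z^n = -1, and Re z <= c for all of them
    ([twisted_cycle_le]).  This settles the cycle.  On the wheel take the
    trivial phase on the spokes and let f be an eigenfunction for l.  If f
    vanishes at the hub, its restriction to the rim is an eigenfunction of the
    cycle for l - 1, so l >= 3 - 2c.  Otherwise, summing the rim equations and
    eliminating the sum of f over the rim leaves the secular equation
    (3 - 2 Re w - l) * (n - l) = n.  Its left side decreases in l below both of
    its zeros, so l < 3 - 2c is impossible as soon as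
    (2c - 2 Re w) * (n - 3 + 2c) >= n.  A phase w close enough to -1 for this is
    provided by [wheel_phase_exists]; the case n = 3 is tight. *)

Set Implicit Arguments.
Unset Strict Implicit.
Unset Printing Implicit Defensive.

Local Open Scope complex_scope.
Local Open Scope sesquilinear_scope.

(** * The Rayleigh principle *)

(** In an orthonormal basis of eigenvectors both sides are sums of squared
    moduli of coordinates, weighted by the eigenvalues on the right. *)
Lemma hermitian_rayleigh (C : numClosedFieldType) n (A : 'M[C]_n) (l : C) :
  A \is hermsymmx -> (forall a, eigenvalue A a -> l <= a) ->
  forall u : 'rV_n, l * (u *m u ^t*) 0 0 <= (u *m A *m u ^t*) 0 0.
Proof.
move=> /hermitian_normalmx/orthomx_spectralP AD minl u.
set P := spectralmx A in AD; set d := spectral_diag A in AD.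
have Pu : P \is unitarymx by exact: spectral_unitarymx.
have PA : P *m A = diag_mx d *m P.
  by rewrite AD !mulmxA mulmxV ?mul1mx // spectral_unit.
have dl i : l <= d 0 i.
  apply: minl; apply/eigenvalueP; exists (row i P).
    by rewrite -row_mul PA row_mul row_diag_mx -scalemxAl -rowE.
  apply/eqP => Pi0; have /row_unitarymxP/(_ i i) := Pu.
  by rewrite Pi0 linear0l eqxx; apply/eqP; rewrite eq_sym oner_eq0.
pose w := u *m P ^t*.
have uE : u = w *m P.
  by rewrite /w -(invmx_unitary Pu) mulmxKV // spectral_unit.
have PP : P *m P ^t* = 1%:M by apply/unitarymxP.
clearbody w; rewrite {u}uE -[w *m P *m A]mulmxA PA !mulmxA.
rewrite trmx_mul map_mxM -!mulmxA !(mulmxA P) PP !mul1mx !mulmxA.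
rewrite mul_mx_diag !mxE mulr_sumr; apply: ler_sum => i _.
rewrite !mxE [leRHS]mulrAC [leRHS]mulrC ler_wpM2r //.
exact: mul_conjC_ge0.
Qed.

Lemma ffun_neq0 (R : realType) (T : finType) (f : {ffun T -> R[i]^o}) :
  f != 0 -> exists x, f x != 0.
Proof.
move=> f0; apply: contrapT => H; move/eqP: f0; apply; apply/ffunP => x.
by rewrite ffunE; apply/eqP/negPn/negP => fx; apply: H; exists x.
Qed.

Section Rayleigh.
Variables (R : realType) (G : sgraph) (sigma : potential R G).

Implicit Types (x y : G) (g : {ffun G -> R[i]^o}).

Definition laplacian_entry x y : R[i] :=
  (x == y)%:R * #|[set z | adj x z]|%:R - (adj x y)%:R * sigma x y.

Lemma laplacian_entryE g x :
  laplacian sigma g x = \sum_y laplacian_entry x y * g y.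
Proof.
rewrite laplacianE sumrB.
under [RHS]eq_bigr => y _ do rewrite mulrBl.
rewrite sumrB; congr (_ - _).
  rewrite [RHS](bigD1 x) //= [X in _ + X]big1 ?addr0; last first.
    by move=> y /negPf yx; rewrite eq_sym yx !mul0r.
  rewrite eqxx mul1r mulr_natl -sumr_const.
  by apply: eq_bigl => y; rewrite inE.
rewrite big_mkcond; apply: eq_bigr => y _.
by case: ifP; rewrite ?mul1r ?mul0r.
Qed.

Lemma laplacian_entry_herm x y :
  laplacian_entry y x = ((laplacian_entry x y)^*)%R.
Proof.
rewrite /laplacian_entry rmorphB !rmorphM !rmorph_nat /=.
rewrite (adj_sym x y) (eq_sym y x); congr (_ - _).
  by case: eqP => [->|_] //; rewrite !mul0r.
case: (boolP (adj y x)) => [yx|]; rewrite ?mul0r // !mul1r.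
have xy : adj x y by rewrite adj_sym.
rewrite (potential_inv sigma xy) invC_norm (potential_norm sigma xy).
by rewrite expr1n invr1 mul1r.
Qed.

(** The equation is required only on the support of f, where it determines the
    Rayleigh quotient: outside, the values of [laplacian sigma f] are multiplied
    by 0.  This is what allows test functions that vanish at the hub. *)
Lemma lambda1_le_compression (f : {ffun G -> R[i]^o}) (mu : R) : f != 0 ->
    (forall x, f x != 0 -> laplacian sigma f x = mu%:C * f x) ->
  lambda1 sigma <= mu.
Proof.
move=> /ffun_neq0[x0 fx0] fE.
have [_ minl] := lambda1_min sigma (ltac:(by apply/card_gt0P; exists x0)).
pose toR (g : {ffun G -> R[i]^o}) : 'rV[R[i]]_#|G| := \row_i g (enum_val i).
pose ofR (u : 'rV[R[i]]_#|G|) : {ffun G -> R[i]^o} :=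
  [ffun x => u 0 (enum_rank x)].
(* Matrices act on row vectors from the right, hence the exchanged indices. *)
pose A : 'M[R[i]]_#|G| :=
  \matrix_(i, j) laplacian_entry (enum_val j) (enum_val i).
have sumE (F : G -> R[i]) : \sum_x F x = \sum_(i < #|G|) F (enum_val i).
  by rewrite (reindex (@enum_val G G)) //; apply: onW_bij; apply: enum_val_bij.
have AE (u : 'rV_#|G|) : u *m A = toR (laplacian sigma (ofR u)).
  apply/rowP => j; rewrite !mxE laplacian_entryE sumE.
  by apply: eq_bigr => i _; rewrite mxE ffunE enum_valK mulrC.
have Aherm : A \is hermsymmx.
  apply/is_hermitianmxP; rewrite expr0 scale1r; apply/matrixP => i j.
  by rewrite !mxE laplacian_entry_herm.
have toRK u : toR (ofR u) = u.
  by apply/rowP => i; rewrite !mxE ffunE enum_valK.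
have ofRK g : ofR (toR g) = g.
  by apply/ffunP => x; rewrite ffunE mxE enum_rankK.
have minA a : eigenvalue A a -> (lambda1 sigma)%:C <= a.
  move=> /eigenvalueP[v vA v0]; apply: minl; apply/leigenvalue_laplacianP.
  exists (ofR v).
    apply: contra v0 => /eqP v0; rewrite -(toRK v) v0; apply/eqP/rowP => i.
    by rewrite !mxE ffunE.
  rewrite -[LHS]ofRK -AE vA; apply/ffunP => x.
  by rewrite !ffunE mxE.
have := hermitian_rayleigh Aherm minA (toR f).
(* Off the support of f the entry of [toR f *m A] is arbitrary but meets a zero
   entry of [toR f ^t*]. *)
have -> : toR f *m A *m toR f ^t* = mu%:C *: (toR f *m toR f ^t*).
  apply/matrixP => i j; rewrite AE ofRK !mxE mulr_sumr; apply: eq_bigr => k _.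
  rewrite !mxE mulrA; have [-> |fk] := eqVneq (f (enum_val k)) 0.
    by rewrite conjC0 !mulr0.
  by rewrite fE.
rewrite [leRHS]mxE ler_pM2r ?lecR //.
rewrite mxE (bigD1 (enum_rank x0)) //= ltr_pwDl //.
  by rewrite !mxE enum_rankK mul_conjC_gt0.
by apply: sumr_ge0 => i _; rewrite !mxE mul_conjC_ge0.
Qed.

End Rayleigh.

(** * Points of the unit circle *)

Section Cis.
Variable R : realType.
Implicit Types (x y : R) (z : R[i]).

Definition cis x : R[i] := cos x +i* sin x.

Lemma cisD x y : cis (x + y) = cis x * cis y.
Proof. by rewrite /cis cosD sinD; simpc; congr (_ +i* _); ring. Qed.

Lemma cis0 : cis 0 = 1.
Proof. by rewrite /cis cos0 sin0. Qed.

Lemma cisX x n : cis x ^+ n = cis (n%:R * x).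
Proof.
elim: n => [|n IHn]; first by rewrite mul0r cis0.
by rewrite exprS IHn -cisD -[n.+1]add1n natrD mulrDl mul1r.
Qed.

Lemma norm_cis x : `|cis x| = 1.
Proof. by rewrite normc_def /= cos2Dsin2 sqrtr1. Qed.

Lemma cis_neq0 x : cis x != 0.
Proof. by rewrite -normr_gt0 norm_cis. Qed.

Lemma cisN x : cis (- x) = (cis x)^-1.
Proof.
by apply: (mulIf (cis_neq0 x)); rewrite -cisD addNr cis0 mulVf ?cis_neq0.
Qed.

Lemma norm1_cisP z : `|z| = 1 -> exists2 x, `|x| <= pi & z = cis x.
Proof.
case: z => a b; rewrite normc_def /= => -[] ab1.
have {}ab1 : a ^+ 2 + b ^+ 2 = 1.
  by rewrite -[LHS]sqr_sqrtr ?ab1 ?expr1n // addr_ge0 ?sqr_ge0.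
have a1 : -1 <= a <= 1 by nra.
have acos_norm : `|acos a| <= pi by rewrite ger0_norm ?acos_ge0 ?acos_lepi.
have sinE : sin (acos a) = `|b|.
  by rewrite sin_acos // -ab1 addrC addKr sqrtr_sqr.
have [b0|b0] := leP 0 b.
  by exists (acos a) => //; rewrite /cis acosK ?in_itv //= sinE ger0_norm.
exists (- acos a); first by rewrite normrN.
by rewrite /cis cosN sinN acosK ?in_itv //= sinE ltr0_norm // opprK.
Qed.

Lemma cis_add_inv x : cis x + (cis x)^-1 = (2 * cos x)%:C.
Proof.
by rewrite -cisN /cis cosN sinN; simpc; congr (_ +i* _); ring.
Qed.

Lemma norm_root1 n z : (0 < n)%N -> z ^+ n = -1 -> `|z| = 1.
Proof.
move=> n0 zn; apply/eqP; rewrite -(@pexpr_eq1 _ _ n) //.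
by rewrite -normrX zn normrN1.
Qed.

(** The n-th roots of -1 are the e^(ix) with nx an odd multiple of pi, and no
    such x lies strictly between -pi/n and pi/n. *)
Lemma rootN1_cis n z : (0 < n)%N -> z ^+ n = -1 ->
  exists2 x, z = cis x & cos x <= cos (pi / n%:R).
Proof.
move=> n0 zn; have [x xpi zx] := norm1_cisP (norm_root1 n0 zn).
exists x => //; rewrite -[cos x]cos_norm leNgt; apply/negP.
have nR : 0 < n%:R :> R by rewrite ltr0n.
have n1 : 1 <= n%:R :> R by rewrite ler1n.
have pi0 := pi_gt0 R.
rewrite ltr_cos ?in_itv /= ?normr_ge0 ?xpi //; last first.
  by rewrite divr_ge0 ?pi_ge0 ?ler0n //= ler_pdivrMr // ler_peMr ?pi_ge0.
rewrite ltr_pdivlMr // mulrC => nx.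
have : cos pi < cos (n%:R * `|x|).
  by rewrite ltr_cos // in_itv /= ?pi_ge0 ?lexx // mulr_ge0 ?normr_ge0 ?ltW.
have -> : n%:R * `|x| = `|n%:R * x| by rewrite normrM normr_nat.
rewrite cos_norm cospi; move: zn; rewrite zx cisX => -[-> _].
by rewrite ltxx.
Qed.

End Cis.

(** * Twisted shifts of the cycle *)

(** At least three vertices ensure that the two neighbours i + 1 and i - 1 of a
    rim vertex differ; the successor shape of the size gives ['I_n] its ring
    structure, in which they are computed. *)
Section CyclicShift.
Variables (R : realType) (m : nat).
Local Notation n := m.+3.

Lemma cyclic_val (i : 'I_n) : val (i + 1) = (i.+1 %% n)%N.
Proof. by rewrite /= addn1. Qed.

Lemma cycle_adjE (i j : 'I_n) : cycle_adj i j = (j == i + 1) || (j == i - 1).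
Proof.
rewrite /cycle_adj -!cyclic_val !(inj_eq val_inj) [j == i - 1]eq_sym subr_eq.
have neq (k : 'I_n) : (k == k + 1) = false.
  by apply/negbTE; rewrite eq_sym -subr_eq0 addrAC subrr add0r.
by case: (eqVneq i j) => [<-|] //=; rewrite neq.
Qed.

Lemma succ_pred_neq (i : 'I_n) : (i - 1 == i + 1) = false.
Proof.
by apply/negbTE; rewrite eq_sym -subr_eq0 opprB addrAC addrCA subrr addr0.
Qed.

Lemma sum_cycle_adj (F : 'I_n -> R[i]) i :
  \sum_(j | cycle_adj i j) F j = F (i + 1) + F (i - 1).
Proof.
rewrite (bigD1 (i + 1)) /=; last by rewrite cycle_adjE eqxx.
rewrite (big_pred1 (i - 1)) // => j; rewrite cycle_adjE /=.
case: (eqVneq j (i + 1)) => [->|] //=; last by rewrite andbT.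
by rewrite eq_sym succ_pred_neq.
Qed.

Lemma shift_iter (a b : R[i]) (v : 'I_n -> R[i]) :
    (forall i, a * v (i + 1) = b * v i) ->
  forall k i, a ^+ k * v (i + k%:R) = b ^+ k * v i.
Proof.
move=> vE; elim=> [|k IHk] i; first by rewrite addr0.
rewrite !exprS -!mulrA [in RHS]mulrCA -vE [in RHS]mulrCA -IHk.
by rewrite mulrS addrA.
Qed.

Lemma shift_eigen_root (a b : R[i]) (v : 'I_n -> R[i]) i0 : v i0 != 0 ->
  (forall i, a * v (i + 1) = b * v i) -> a ^+ n = b ^+ n.
Proof.
move=> v0 /shift_iter/(_ n i0).
have -> : n%:R = 0 :> 'I_n by rewrite Zp_nat; apply: val_inj; rewrite /= modnn.
by rewrite addr0 => /(mulIf v0).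
Qed.

(** With T the twisted shift, T + T^-1 = t on v.  Factor X^2 - t X + 1 as
    (X - z) (X - z^-1).  Either (T - z^-1) v is an eigenvector of T for z, or it
    vanishes and v is one for z^-1.  As T^n = w^n = -1, in both cases z^n = -1,
    and t = z + z^-1 = 2 Re z. *)
Lemma twisted_cycle_le (w : R[i]) (t : R) (v : 'I_n -> R[i]) i0 :
    w ^+ n = -1 -> v i0 != 0 ->
    (forall i, w * v (i + 1) + w^-1 * v (i - 1) = t%:C * v i) ->
  t <= 2 * cos (pi / n%:R).
Proof.
move=> wn v0 vE.
have w0 : w != 0 by rewrite -normr_gt0 (norm_root1 _ wn).
pose z := (t%:C + sqrtC (t%:C ^+ 2 - 4)) / 2.
have z2 : z ^+ 2 + 1 = t%:C * z.
  have := sqrtCK (t%:C ^+ 2 - 4); rewrite /z; set r := sqrtC _ => rE.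
  have -> : ((t%:C + r) / 2) ^+ 2 + 1 =
            (t%:C ^+ 2 + 2 * t%:C * r + r ^+ 2) / 4 + 1 by field.
  by rewrite rE; field.
have z0 : z != 0.
  apply/eqP => z0; move: z2; rewrite z0 mulr0 expr0n add0r => /eqP.
  by rewrite oner_eq0.
have tE : z + z^-1 = t%:C.
  by apply: (mulIf z0); rewrite -z2 mulrDl mulVf.
suff zn : z ^+ n = -1.
  have [x zx xle] := rootN1_cis (ltn0Sn _) zn.
  by move: tE; rewrite zx cis_add_inv => -[<-]; rewrite ler_pM2l.
pose u i := w * v (i + 1) - z^-1 * v i.
have [[i ui0]|u0] := pselect (exists i, u i != 0).
  rewrite -wn; symmetry; apply: (shift_eigen_root ui0) => j.
  have vE1 : w * v (j + 1 + 1) = (z + z^-1) * v (j + 1) - w^-1 * v j.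
    by rewrite tE -vE addrK [in RHS]addrK.
  by rewrite /u vE1; field; rewrite z0.
have uE i : w * v (i + 1) = z^-1 * v i.
  by apply/eqP; rewrite -subr_eq0; apply/negPn/negP => ui; apply: u0; exists i.
have := shift_eigen_root v0 uE; rewrite wn exprVn => zn.
by rewrite -[z ^+ _]invrK -zn invrN1.
Qed.

(** The total phase of s around the cycle is e^(ix) with |x| <= pi; dividing it
    evenly among the n edges leaves e^(ix/n) on each of them. *)
Lemma cycle_twist (s : 'I_n -> R[i]) : (forall i, `|s i| = 1) ->
  exists x, exists2 g : 'I_n -> R[i], cos (pi / n%:R) <= cos x &
    (forall i, g i != 0) /\ (forall i, s i * g (i + 1) = cis x * g i).
Proof.
move=> s1; pose P k : R[i] := \prod_(0 <= j < k) s (inord j).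
have P1 k : `|P k| = 1.
  by rewrite normr_prod big1.
have [x xpi Px] := norm1_cisP (P1 n).
have nR : 0 < n%:R :> R by rewrite ltr0n.
have n1 : 1 <= n%:R :> R by rewrite ler1n.
have P0 k : P k != 0 by rewrite -normr_gt0 P1.
exists (x / n%:R), (fun i : 'I_n => cis (x / n%:R) ^+ i / P i).
  rewrite -[leRHS]cos_norm leNgt ltr_cos ?in_itv /= ?normr_ge0 //.
  - by rewrite -leNgt normrM normfV normr_nat ler_pM2r ?invr_gt0.
  - by rewrite divr_ge0 ?pi_ge0 ?ler0n //= ler_pdivrMr // ler_peMr ?pi_ge0.
  - rewrite normrM normfV normr_nat ler_pdivrMr // (le_trans xpi) //.
    by rewrite ler_peMr ?pi_ge0.
split=> i; first by rewrite mulf_neq0 ?expf_neq0 ?cis_neq0 ?invr_eq0.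
have PS : P i.+1 = P i * s i by rewrite /P big_nat_recr //= inord_val.
have si0 : s i != 0 by rewrite -normr_gt0 s1.
have key : s i * (cis (x / n%:R) ^+ i.+1 / P i.+1) =
           cis (x / n%:R) * (cis (x / n%:R) ^+ i / P i).
  by rewrite PS exprS; field; rewrite P0.
rewrite -key; congr (_ * _); rewrite cyclic_val.
(* Only the edge from n - 1 back to 0 involves the choice of x. *)
have := ltn_ord i; rewrite leq_eqVlt => /predU1P[->|lt_i]; last first.
  by rewrite modn_small.
rewrite modnn [P 0]big_nil expr0 cisX [n%:R * _]mulrC divfK ?lt0r_neq0 // Px.
by rewrite divr1 divff ?cis_neq0.
Qed.

End CyclicShift.

(** * The phase on the rim of the wheel *)

Lemma half_le_cos (R : realType) (n : nat) : (3 <= n)%N ->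
  1 / 2 <= cos (pi / n%:R) :> R.
Proof.
move=> n3; have pi0 := pi_gt0 R.
have nR : 3 <= n%:R :> R by rewrite ler_nat.
have n0 : 0 < n%:R :> R by rewrite ltr0n (leq_trans _ n3).
have cos3 : 1 / 2 <= cos (pi / 3) :> R.
  have c0 : 0 <= cos (pi / 3) :> R.
    by apply: cos_ge0_pihalf; apply/andP; split; lra.
  (* cos (3x) = 4 (cos x)^3 - 3 cos x at x = pi / 3 *)
  have : cos (pi / 3 *+ 2 + pi / 3) = -1 :> R.
    by rewrite -cospi; congr cos; field.
  rewrite cosD cos_mulr2n sin_mulr2n mulrnAl -mulrA -expr2 sin2cos2.
  move: (cos _) c0 => c c0 cE; have : (c + 1) * (2 * c - 1) ^+ 2 = 0 by nra.
  by move=> /eqP; rewrite mulf_eq0 sqrf_eq0 => /orP[] /eqP; lra.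
rewrite (le_trans cos3) // leNgt ltr_cos ?in_itv /=.
- by rewrite -leNgt ler_pM2l // lef_pV2 // posrE.
- by apply/andP; split; lra.
- apply/andP; split; first exact: divr_ge0 (ltW _) (ltW _).
  by rewrite ler_pdivrMr //; nra.
Qed.

(** With a = 2 Re w, the two inequalities on a keep the roots of the secular
    equation (3 - a - l) * (n - l) = n of the wheel from lying below 3 - 2c.  The phase w = -1 is an n-th root of -1 only for odd n; for
    even n the nearest roots to -1 are - e^(+-i pi/n).  The bound c >= 1/2
    suffices in both cases, as an even n is at least 4. *)
Lemma wheel_phase_exists (R : realType) (n : nat) : (3 <= n)%N ->
  exists w : R[i], exists2 a : R, w ^+ n = -1 /\ w + w^-1 = a%:C &
    a < 2 * cos (pi / n%:R) /\
    n%:R <= (2 * cos (pi / n%:R) - a) * (n%:R - 3 + 2 * cos (pi / n%:R)).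
Proof.
move=> n3; have c2 := half_le_cos R n3; set c := cos _ in c2 *.
have nR : 3 <= n%:R :> R by rewrite ler_nat.
case: (boolP (odd n)) => [odd_n|even_n].
  exists (-1), (- 2); last by split; nra.
  rewrite -signr_odd odd_n expr1 invrN1; split=> //.
  by rewrite rmorphN rmorphD /=; ring.
exists (- cis (pi / n%:R)), (- (2 * c)).
  split.
    rewrite exprNn -signr_odd (negPf even_n) expr0 mul1r cisX mulrC divfK.
      by rewrite /cis cospi sinpi; apply/eqP; rewrite eq_complex /= oppr0 !eqxx.
    by rewrite pnatr_eq0; case: (n) n3.
  by rewrite invrN -opprD cis_add_inv rmorphN.
have n4 : 4 <= n%:R :> R.
  by rewrite ler_nat ltn_neqAle n3 andbT; apply: contra even_n => /eqP <-.
by split; nra.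
Qed.

(** * Laplacians of the cycle and of the wheel *)

Section Graphs.
Variables (R : realType) (m : nat).
Local Notation n := m.+3.
Local Notation c := (cos (pi / n%:R) : R).

Lemma cycle_laplacianE (sigma : potential R (cycle_graph n))
    (f : {ffun cycle_graph n -> R[i]^o}) (i : 'I_n) :
  laplacian sigma f i = (f i - sigma i (i + 1) * f (i + 1))
                        + (f i - sigma i (i - 1) * f (i - 1)).
Proof.
by rewrite laplacianE (sum_cycle_adj (fun j => f i - sigma i j * f j)).
Qed.

Lemma sum_option (V : nmodType) (T : finType) (F : option T -> V)
    (P : pred (option T)) :
  \sum_(y | P y) F y =
  (if P None then F None else 0) + \sum_(j | P (Some j)) F (Some j).
Proof.
rewrite big_mkcond (bigD1 None) //=; congr (_ + _).
rewrite [RHS]big_mkcond (reindex_omap Some id) => [|[]] //=.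
by apply: eq_bigl => j; rewrite eqxx.
Qed.

Lemma wheel_laplacian_rim (sigma : potential R (wheel_graph n))
    (f : {ffun wheel_graph n -> R[i]^o}) (i : 'I_n) :
  laplacian sigma f (Some i) =
    (f (Some i) - sigma (Some i) None * f None) +
    ((f (Some i) - sigma (Some i) (Some (i + 1)) * f (Some (i + 1)))
      + (f (Some i) - sigma (Some i) (Some (i - 1)) * f (Some (i - 1)))).
Proof.
rewrite laplacianE.
rewrite (sum_option (fun y => f (Some i) - sigma (Some i) y * f y)) /=.
by rewrite (sum_cycle_adj
  (fun j => f (Some i) - sigma (Some i) (Some j) * f (Some j))).
Qed.

Lemma wheel_laplacian_hub (sigma : potential R (wheel_graph n))
    (f : {ffun wheel_graph n -> R[i]^o}) :
  laplacian sigma f None =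
    \sum_(j < n) (f None - sigma None (Some j) * f (Some j)).
Proof.
rewrite laplacianE (sum_option (fun y => f None - sigma None y * f y)) /=.
by rewrite add0r.
Qed.

(** Used with g from [cycle_twist], s and s' being the phases of a potential
    towards the successor and the predecessor: g is also twisted by
    e^(-ix) in the backward direction, so x enters only through its cosine. *)
Lemma laplacian_twist (s s' g : 'I_n -> R[i]) x :
    (forall i, s' (i + 1) = (s i)^-1) -> (forall i, s i != 0) ->
    (forall i, s i * g (i + 1) = cis x * g i) ->
  forall i, (g i - s i * g (i + 1)) + (g i - s' i * g (i - 1)) =
    (2 - 2 * cos x)%:C * g i.
Proof.
move=> s's s0 gE i.
have -> : s' i * g (i - 1) = (cis x)^-1 * g i.
  have := s's (i - 1); have := gE (i - 1); rewrite subrK => gEi ->.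
  by apply: (mulfI (s0 (i - 1))); rewrite mulVKf // mulrCA gEi mulKf ?cis_neq0.
by rewrite gE rmorphB rmorph_nat /= -cis_add_inv; ring.
Qed.

Lemma cycle_succ_adj (i : 'I_n) : cycle_adj i (i + 1).
Proof. by rewrite cycle_adjE eqxx. Qed.

(** * Upper bounds *)

Lemma lambda1_cycle_le (sigma : potential R (cycle_graph n)) :
  lambda1 sigma <= 2 - 2 * c.
Proof.
have s1 (i : 'I_n) : `|sigma i (i + 1)| = 1.
  by apply: potential_norm; exact: cycle_succ_adj.
have [x [g cx [g0 gE]]] := cycle_twist s1.
suff : lambda1 sigma <= 2 - 2 * cos x by lra.
pose f : {ffun cycle_graph n -> R[i]^o} := [ffun i => g i].
apply: (lambda1_le_compression (f := f)).
  by apply/eqP => /ffunP/(_ 0); rewrite !ffunE => /eqP; rewrite (negPf (g0 _)).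
move=> i _; rewrite cycle_laplacianE !ffunE.
apply: (laplacian_twist (s := fun i => sigma i (i + 1))
  (s' := fun i => sigma i (i - 1))) => //.
  by move=> j; rewrite addrK (potential_inv sigma (cycle_succ_adj j)).
by move=> j; rewrite -normr_gt0 s1.
Qed.

Lemma lambda1_wheel_le (sigma : potential R (wheel_graph n)) :
  lambda1 sigma <= 3 - 2 * c.
Proof.
have adjS (i : 'I_n) : @adj (wheel_graph n) (Some i) (Some (i + 1)).
  exact: cycle_succ_adj.
have s1 (i : 'I_n) : `|sigma (Some i) (Some (i + 1))| = 1.
  by rewrite potential_norm.
have [x [g cx [g0 gE]]] := cycle_twist s1.
suff : lambda1 sigma <= 1 + (2 - 2 * cos x) by lra.
pose f : {ffun wheel_graph n -> R[i]^o} :=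
  [ffun y => if y is Some i then g i else 0].
apply: (lambda1_le_compression (f := f)).
  apply/eqP => /ffunP/(_ (Some 0)); rewrite !ffunE => /eqP.
  by rewrite (negPf (g0 _)).
case=> [i|] ; last by rewrite ffunE eqxx.
move=> _; rewrite wheel_laplacian_rim !ffunE mulr0 subr0.
rewrite (laplacian_twist (s := fun i => sigma (Some i) (Some (i + 1)))
  (s' := fun i => sigma (Some i) (Some (i - 1))) _ _ gE).
- by rewrite [(1 + _)%:C]rmorphD [RHS]mulrDl rmorph1 [1 * _]mul1r.
- by move=> j; rewrite addrK (potential_inv sigma (adjS j)).
- by move=> j; rewrite -normr_gt0 s1.
Qed.

(** * Lower bounds *)

Section UniformPotential.
Variables (w : R[i]) (w1 : `|w| = 1).

Definition rim_fun (i j : 'I_n) : R[i] := if j == i + 1 then w else w^-1.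

Lemma rim_norm (i j : 'I_n) : `|rim_fun i j| = 1.
Proof. by rewrite /rim_fun; case: ifP; rewrite ?normfV w1 ?invr1. Qed.

Lemma rim_inv (i j : 'I_n) : cycle_adj i j -> rim_fun j i = (rim_fun i j)^-1.
Proof.
rewrite cycle_adjE /rim_fun => /orP[] /eqP ->.
  by rewrite eqxx; have := succ_pred_neq (i + 1); rewrite addrK => ->.
by rewrite succ_pred_neq subrK eqxx invrK.
Qed.

Definition cycle_potential : potential R (cycle_graph n) :=
  @Potential R (cycle_graph n) rim_fun (fun i j _ => rim_norm i j) rim_inv.

Definition wheel_fun (x y : option 'I_n) : R[i] :=
  if (x, y) is (Some i, Some j) then rim_fun i j else 1.

Lemma wheel_norm (x y : wheel_graph n) : adj x y -> `|wheel_fun x y| = 1.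
Proof. by case: x y => [i|] [j|] _; rewrite /= ?normr1 ?rim_norm. Qed.

Lemma wheel_inv (x y : wheel_graph n) :
  adj x y -> wheel_fun y x = (wheel_fun x y)^-1.
Proof. by case: x y => [i|] [j|] //= ij; rewrite ?invr1 //; exact: rim_inv. Qed.

Definition wheel_potential : potential R (wheel_graph n) :=
  Potential wheel_norm wheel_inv.

Hypothesis wn : w ^+ n = -1.

Lemma lambda1_cycle_ge : 2 - 2 * c <= lambda1 cycle_potential.
Proof.
have [] := lambda1_min cycle_potential (ltac:(by rewrite card_ord)).
set l := lambda1 _ => /leigenvalue_laplacianP[f /ffun_neq0[i0 fi0] fE] _.
suff : 2 - l <= 2 * c by lra.
apply: (twisted_cycle_le (v := f) wn fi0) => i.
move/ffunP: fE => /(_ i).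
rewrite cycle_laplacianE ffunE /= /rim_fun eqxx succ_pred_neq.
rewrite -[l%:C *: f i]/(l%:C * f i) => fE.
by rewrite rmorphB mulrBl -fE rmorphD rmorph1 /=; ring.
Qed.

(** Summing the rim equations gives (3 - a - l) * S = n * h and the hub equation
    (n - l) * h = S, where h is the value at the hub and S the sum over the
    rim. *)
Lemma lambda1_wheel_ge (a : R) : w + w^-1 = a%:C -> a < 2 * c ->
    n%:R <= (2 * c - a) * (n%:R - 3 + 2 * c) ->
  3 - 2 * c <= lambda1 wheel_potential.
Proof.
move=> wa ac cond.
have [] := lambda1_min wheel_potential (ltac:(by rewrite card_option)).
set l := lambda1 _ => /leigenvalue_laplacianP[f f0 fE] _.
rewrite leNgt; apply/negP => lc.
pose h : R[i] := f None; pose v i : R[i] := f (Some i); pose S := \sum_i v i.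
have rimE i : l%:C * v i =
    (v i - h) + ((v i - w * v (i + 1)) + (v i - w^-1 * v (i - 1))).
  move/ffunP: fE => /(_ (Some i)).
  rewrite wheel_laplacian_rim ffunE /= /wheel_fun /rim_fun.
  rewrite eqxx succ_pred_neq mul1r.
  exact: esym.
have hubE : l%:C * h = n%:R * h - S.
  move/ffunP: fE => /(_ None).
  rewrite wheel_laplacian_hub ffunE => /esym.
  rewrite sumrB sumr_const card_ord -[_ *+ _]mulr_natl => hE.
  rewrite -[LHS]/(l%:C *: f None) hE; congr (_ - _).
  by apply: eq_bigr => j _; rewrite mul1r.
have [h0|h0] := eqVneq h 0.
  have [[i|] fi] := ffun_neq0 f0; last by case/eqP: fi.
  suff : 3 - l <= 2 * c by lra.
  apply: (twisted_cycle_le (v := v) wn fi) => j.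
  by rewrite rmorphB mulrBl rimE h0 !rmorphD !rmorph1 /=; ring.
have SE : l%:C * S = (3 - a%:C) * S - n%:R * h.
  rewrite mulr_sumr; under eq_bigr => i _ do rewrite rimE.
  rewrite !big_split /= !sumrN -!mulr_sumr sumr_const card_ord.
  have -> : \sum_i v (i + 1) = S by rewrite [RHS](reindex_inj (addIr 1)).
  have -> : \sum_i v (i - 1) = S by rewrite [RHS](reindex_inj (addIr (-1))).
  rewrite -wa -/S -mulr_natl; ring.
have S_hub : S = (n%:R - l%:C) * h by rewrite mulrBl hubE; ring.
have : ((3 - a - l) * (n%:R - l) - n%:R)%:C * h = 0.
  rewrite rmorphB rmorphM !rmorphB !rmorph_nat mulrBl -mulrA -S_hub.
  by rewrite mulrBl SE; ring.
move=> /eqP; rewrite mulf_eq0 (negPf h0) orbF => /eqP[] secular.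
have q0 : 0 < 2 * c - a by lra.
have s0 : 0 < n%:R - 3 + 2 * c.
  by rewrite -(pmulr_rgt0 _ q0) (lt_le_trans _ cond) // ltr0n.
have : (2 * c - a) * (n%:R - 3 + 2 * c) < (3 - a - l) * (n%:R - l).
  by apply: ltr_pM; rewrite ?ltW //; lra.
lra.
Qed.

End UniformPotential.
End Graphs.

Theorem proposition2p12 (R : realType) (n : nat) (hn : (3 <= n)%N) :
  nu R (wheel_graph n) = nu R (cycle_graph n) + 1 /\
  nu R (cycle_graph n) + 1 = 3 - 2 * cos (pi / n%:R).
Proof.
have [w [a [wn wa] [ac cond]]] := wheel_phase_exists R hn.
have w1 : `|w| = 1 by apply: norm_root1 wn; apply: leq_trans hn.
case: n hn wn ac cond => [|[|[|m]]] // _ wn ac cond.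
have sup_eq (G : sgraph) (b : R) (sigma0 : potential R G) :
    (forall sigma : potential R G, lambda1 sigma <= b) ->
    b <= lambda1 sigma0 -> nu R G = b.
  move=> ub lb; apply/eqP; rewrite eq_le; apply/andP; split.
    by apply: ge_sup; [exists (lambda1 sigma0), sigma0 | move=> _ [s _ <-]].
  apply: le_trans lb _; apply: ub_le_sup; last by exists sigma0.
  by exists b => _ [s _ <-].
rewrite (sup_eq _ _ _ (@lambda1_cycle_le R m) (lambda1_cycle_ge w1 wn)).
rewrite (sup_eq _ _ _ (@lambda1_wheel_le R m)
  (lambda1_wheel_ge w1 wn wa ac cond)).
by split; lra.
Qed.
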